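(* Let $\mathbf{k}$ be a commutative ring with $1$, let $n\geq 2$, $V=\mathbf{k}^n$, and $S=\mathbf{k}[x_1,\ldots,x_n]=S(V)$. Fix an integer $d\geq 1$ and let $R=S^{(d)}$. For integers $r,r'\geq 0$, consider the three $R$-modules $M=S^{(\geq r,d)}$, $M'=S^{(\geq r',d)}$, $M''=S^{(\geq r'',d)}$, where $r'':=r'-r$ if $r\leq r'$, and otherwise, if $r>r'$, $r''$ is the unique integer in $[0,d)$ congruent to $r'-r$ modulo $d$. Then the map $$M''\longrightarrow\operatorname{Hom}_R(M,M'),\qquad m''\longmapsto(m\mapsto m''\cdot m)$$ is a $GL(V)$-equivariant $R$-module isomorphism.
   Context: Let $x_1,\ldots,x_n$ be the $\mathbf{k}$-basis of $V$. $S=\bigoplus_j S_j$ has the standard grading, and $GL(V)\cong GL_n(\mathbf{k})$ acts on $S$ by $\mathbf{k}$-algebra automorphisms extending its action on $V$. The $d$th Veronese subalgebra is $S^{(d)}=\bigoplus_{j\equiv 0 \bmod d}S_j$, and for $r\ge 0$, $S^{(\geq r,d)}=\bigoplus_{j\ge r,\ j\equiv r \bmod d}S_j$, an $S^{(d)}$-submodule of $S$. An element $g\in GL(V)$ acts on $\operatorname{Hom}_R(M,M')$ by $\varphi\mapsto g\circ\varphi\circ g^{-1}$. *)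

(* Defs.v *)
From HB Require Import structures.
From mathcomp Require Import all_boot all_algebra.
From mathcomp Require Import mpoly.
From mathcomp Require boolp.

Set Implicit Arguments.
Unset Strict Implicit.
Unset Printing Implicit Defensive.

Import GRing.Theory.
Local Open Scope ring_scope.

(* Hom_R(U, V) for R commutative is {linear U -> V}, with the pointwise R-module
   structure; its eqType and choiceType structures are the classical ones. *)

Section HomModule.
Context (R : comNzRingType) (U V : lmodType R).
Implicit Types f g h : {linear U -> V}.

HB.instance Definition _ := boolp.gen_eqMixin {linear U -> V}.
HB.instance Definition _ := boolp.gen_choiceMixin {linear U -> V}.

Lemma homP f g : f =1 g <-> f = g.
Proof.
split=> [fg|fg x]; last by rewrite fg.
case: f g fg => [f cf] [g cg] /boolp.funext /= fg.
case: _ / fg cg => cg; congr GRing.Linear.Pack.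
case: cf cg => [[f1] [f2]] [[g1] [g2]].
by rewrite (boolp.Prop_irrelevance f1 g1) (boolp.Prop_irrelevance f2 g2).
Qed.

Definition hom0 : {linear U -> V} := (\0 : U -> V).
Definition homN f : {linear U -> V} := \- f.
Definition homD f g : {linear U -> V} := f \+ g.
Definition homZ (a : R) f : {linear U -> V} := a \*: f.

Lemma homDA : associative homD.
Proof. by move=> f g h; apply/homP=> x; apply: addrA. Qed.
Lemma homDC : commutative homD.
Proof. by move=> f g; apply/homP=> x; apply: addrC. Qed.
Lemma hom0D : left_id hom0 homD.
Proof. by move=> f; apply/homP=> x; apply: add0r. Qed.
Lemma homND : left_inverse hom0 homN homD.
Proof. by move=> f; apply/homP=> x; apply: addNr. Qed.
HB.instance Definition _ :=
  GRing.isZmodule.Build {linear U -> V} homDA homDC hom0D homND.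

Lemma homZA a b f : homZ a (homZ b f) = homZ (a * b) f.
Proof. by apply/homP=> x; apply: scalerA. Qed.
Lemma hom1Z : left_id 1 homZ.
Proof. by move=> f; apply/homP=> x; apply: scale1r. Qed.
Lemma homZDr : right_distributive homZ +%R.
Proof. by move=> a f g; apply/homP=> x; apply: scalerDr. Qed.
Lemma homZDl f : {morph homZ^~ f : a b / a + b}.
Proof. by move=> a b; apply/homP=> x; apply: scalerDl. Qed.
HB.instance Definition _ := GRing.Zmodule_isLmodule.Build R {linear U -> V}
  homZA hom1Z homZDr homZDl.

End HomModule.

(* The k-submodule \bigoplus_(j | J j) S_j of S = {mpoly k[n]}: S_j is spanned
   by the monomials of degree j (see degpartE). *)

Definition degpart (k : comNzRingType) (n : nat) (J : pred nat) :
    pred {mpoly k[n]} :=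
  fun p => all (fun m => J (mdeg m)) (msupp p).
Arguments degpart : clear implicits.

Section DegPart.
Context (k : comNzRingType) (n : nat).
Implicit Types (J : pred nat) (p q : {mpoly k[n]}).

Lemma degpartP J p :
  reflect {in msupp p, forall m, J (mdeg m)} (p \in degpart k n J).
Proof. exact: allP. Qed.

Lemma degpart_zmod J : zmod_closed (degpart k n J).
Proof.
split=> [|p q /degpartP hp /degpartP hq]; first by apply/degpartP; rewrite msupp0.
apply/degpartP=> m /msuppB_le; rewrite mem_cat.
by case/orP; [apply: hp | apply: hq].
Qed.
HB.instance Definition _ J :=
  GRing.isZmodClosed.Build {mpoly k[n]} (degpart k n J) (degpart_zmod J).

Lemma degpartE J p : p \in degpart k n J <->
  p = \sum_(j < msize p | J j) pihomog mdeg j p.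
Proof.
split=> [/degpartP Jp | ->].
  rewrite [LHS](@pihomog_partitionE _ _ mdeg (msize p)) ?mmeasureE ?msizeE //.
  rewrite (bigID (fun j : 'I__ => J j)) /= [X in _ + X]big1 ?addr0 // => j nJj.
  rewrite pihomogE big_seq_cond big1 // => m /andP[/Jp Jm /eqP mj].
  by rewrite -mj Jm in nJj.
apply: rpred_sum => j Jj; apply/degpartP => m.
by move/(dhomogP _ _ _ (pihomogP mdeg j p)) => ->.
Qed.

Lemma degpartM J1 J2 J p q :
    (forall i j, J1 i -> J2 j -> J (i + j)%N) ->
  p \in degpart k n J1 -> q \in degpart k n J2 -> p * q \in degpart k n J.
Proof.
move=> hJ /degpartP hp /degpartP hq; apply/degpartP=> m.
case/msuppM_le/allpairsP=> -[m1 m2] /= [/hp h1 /hq h2 ->].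
by rewrite mdegD; apply: hJ.
Qed.

End DegPart.

Record gpart (k : comNzRingType) (n : nat) (J : pred nat) := GPart {
  gpval : {mpoly k[n]};
  _ : gpval \in degpart k n J
}.

HB.instance Definition _ k n J := [isSub for @gpval k n J].
HB.instance Definition _ k n J := [Choice of gpart k n J by <:].
HB.instance Definition _ k n J :=
  [SubChoice_isSubZmodule of gpart k n J by <:].

(* veronese k n d is S^(d), and vermod k n d r is S^(>= r, d). *)

Definition veronese_deg (d : nat) : pred nat := fun j => (d %| j)%N.
Definition vermod_deg (d r : nat) : pred nat :=
  fun j => (r <= j)%N && (j == r %[mod d])%N.

Definition veronese (k : comNzRingType) (n d : nat) : Type :=
  gpart k n (veronese_deg d).
Definition vermod (k : comNzRingType) (n d r : nat) : Type :=
  gpart k n (vermod_deg d r).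

Section Veronese.
Context (k : comNzRingType) (n d : nat).

Lemma veronese_subring : subring_closed (degpart k n (veronese_deg d)).
Proof.
split=> [|p q|p q]; last 2 first.
- exact: rpredB.
- by apply: degpartM => i j; apply: dvdn_add.
by apply/degpartP=> m; rewrite msupp1 inE => /eqP ->; rewrite mdeg0 /veronese_deg dvdn0.
Qed.

HB.instance Definition _ := SubChoice.on (veronese k n d).
HB.instance Definition _ := GRing.SubChoice_isSubComNzRing.Build
  _ _ (veronese k n d) veronese_subring.

Context (r : nat).

HB.instance Definition _ := GRing.SubZmodule.on (vermod k n d r).

Lemma veronese_scale_subproof (a : veronese k n d) (m : vermod k n d r) :
  val a * val m \in degpart k n (vermod_deg d r).
Proof.
apply: degpartM (valP a) (valP m) => i j di /andP[rj /eqP jr].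
by rewrite /vermod_deg (leq_trans rj (leq_addl _ _)) /= -modnDml (eqP di) add0n jr.
Qed.

Definition veronese_scale (a : veronese k n d) (m : vermod k n d r) :
  vermod k n d r := GPart (veronese_scale_subproof a m).

Lemma veronese_scaleA a b m :
  veronese_scale a (veronese_scale b m) = veronese_scale (a * b) m.
Proof. by apply: val_inj; rewrite /= mulrA. Qed.
Lemma veronese_scale1 : left_id 1 veronese_scale.
Proof. by move=> m; apply: val_inj; rewrite /= mul1r. Qed.
Lemma veronese_scaleDr : right_distributive veronese_scale +%R.
Proof. by move=> a m m'; apply: val_inj; rewrite /= mulrDr. Qed.
Lemma veronese_scaleDl m : {morph veronese_scale^~ m : a b / a + b}.
Proof. by move=> a b; apply: val_inj; rewrite /= mulrDl. Qed.
HB.instance Definition _ := GRing.Zmodule_isLmodule.Build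
  (veronese k n d) (vermod k n d r)
  veronese_scaleA veronese_scale1 veronese_scaleDr veronese_scaleDl.

End Veronese.
Arguments veronese_scale : simpl never.

(* GL(V) for V = k^n: invertible matrices, packaged with the inverse since
   unitmx requires a comUnitRingType and 'GL_n[k] a finite ring. *)

Record GL (k : comNzRingType) (n : nat) := MkGL {
  GLmx :> 'M[k]_n;
  GLinvmx : 'M[k]_n;
  GLmxV : GLmx *m GLinvmx = 1%:M;
  GLVmx : GLinvmx *m GLmx = 1%:M
}.

Definition GLinv (k : comNzRingType) (n : nat) (g : GL k n) : GL k n :=
  MkGL (GLVmx g) (GLmxV g).

Section GLAction.
Context (k : comNzRingType) (n : nat).
Implicit Types (g h : 'M[k]_n) (p : {mpoly k[n]}).

(* The k-algebra endomorphism of S extending x_j |-> \sum_i g_ij x_i, that is,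
   g acting on the column vectors of V = k^n with basis x_0, ..., x_(n-1). *)
Definition glsubst g p : {mpoly k[n]} :=
  p \mPo [tuple \sum_i g i j *: 'X_i | j < n].
HB.instance Definition _ g := GRing.LRMorphism.copy (glsubst g)
  (comp_mpoly [tuple \sum_i g i j *: ('X_i : {mpoly k[n]}) | j < n]).

Lemma glsubstXU g j : glsubst g 'X_j = \sum_i g i j *: 'X_i.
Proof. by rewrite /glsubst comp_mpolyXU -tnth_nth tnth_mktuple. Qed.

Lemma glsubst1 p : glsubst 1%:M p = p.
Proof.
rewrite -[RHS]comp_mpoly_id /glsubst; congr (_ \mPo _).
apply: eq_from_tnth => j; rewrite !tnth_mktuple (bigD1 j) //= big1.
  by rewrite mxE eqxx scale1r addr0.
by move=> i /negPf ij; rewrite mxE ij scale0r.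
Qed.

Lemma glsubstM g h p : glsubst (g *m h) p = glsubst g (glsubst h p).
Proof.
have E f : glsubst f p = \sum_(m <- msupp p) p@_m *: glsubst f 'X_[m].
  exact: comp_mpolyEX.
rewrite !E linear_sum /=; apply: eq_bigr => m _.
rewrite linearZ /=; congr (_ *: _).
rewrite mpolyXE_id !rmorph_prod; apply: eq_bigr => j _.
rewrite !rmorphXn /= !glsubstXU linear_sum /=; congr (_ ^+ _).
under [RHS]eq_bigr do rewrite linearZ /= glsubstXU scaler_sumr.
rewrite exchange_big /=; apply: eq_bigr => i _.
rewrite mxE scaler_suml; apply: eq_bigr => l _.
by rewrite scalerA mulrC.
Qed.

Lemma glsubst_degpart J g p :
  p \in degpart k n J -> glsubst g p \in degpart k n J.
Proof.
move=> /degpartP Jp; rewrite /glsubst comp_mpolyE big_seq.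
apply: rpred_sum => m /Jp Jm; apply/degpartP => m' /msuppZ_le m'P.
suff /dhomogP/(_ _ m'P) -> : \prod_(j < n)
    tnth [tuple \sum_i g i j *: ('X_i : {mpoly k[n]}) | j < n] j ^+ m j
    \is (mdeg m).-homog by [].
rewrite mdegE; elim/big_rec2: _ => [|j a q _ hq]; first exact: dhomog1.
apply: dhomogM hq; rewrite -[X in X.-homog]mul1n; apply: dhomogMn.
rewrite tnth_mktuple; apply: rpred_sum => i _; apply: rpredZ.
by rewrite dhomogX /= mdeg1.
Qed.

Definition glact J (g : GL k n) (m : gpart k n J) : gpart k n J :=
  GPart (glsubst_degpart g (valP m)).

Lemma glactK J (g : GL k n) : cancel (@glact J (GLinv g)) (glact g).
Proof.
move=> m; apply: val_inj.
by rewrite /= -glsubstM GLmxV glsubst1.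
Qed.

Context (d r r' : nat).
Local Notation M := (vermod k n d r).
Local Notation M' := (vermod k n d r').

Definition glconj_fun (g : GL k n) (phi : {linear M -> M'}) : M -> M' :=
  glact g \o phi \o glact (GLinv g).

Lemma glconj_fun_is_linear (g : GL k n) (phi : {linear M -> M'}) :
  linear (glconj_fun g phi).
Proof.
move=> a m1 m2; rewrite /glconj_fun /=.
have glD J (h : GL k n) : {morph @glact J h : x y / x + y}.
  by move=> x y; apply: val_inj; rewrite /= raddfD.
have glZ t (h : GL k n) b (m : vermod k n d t) :
    glact h (b *: m) = (glact h b : veronese k n d) *: (glact h m : vermod k n d t).
  by apply: val_inj; rewrite /= rmorphM.
by rewrite glD glZ linearP glD glZ glactK.
Qed.

HB.instance Definition _ (g : GL k n) (phi : {linear M -> M'}) :=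
  GRing.isLinear.Build _ _ _ *:%R (glconj_fun g phi) (glconj_fun_is_linear g phi).

(* g acts on Hom_R(M, M') by phi |-> g o phi o g^-1. *)
Definition glconj (g : GL k n) (phi : {linear M -> M'}) : {linear M -> M'} :=
  glconj_fun g phi.

End GLAction.

(* Main.v *)
Require Import Defs.
From HB Require Import structures.
From mathcomp Require Import all_boot all_algebra.
From mathcomp Require Import mpoly.
From mathcomp Require boolp.

(** A product of elements of S_i and S_j lies in S_(i + j), so whether S_i
    multiplies M into M' is a question about i; [vermod_deg_shift] says that the
    answer is positive exactly when i is a degree of M''. Hence the map is well
    defined, and it is injective because M contains the monomial x_1^r, which
    is not a zero divisor over any k.

    For surjectivity, let phi be R-linear on M. The ratio phi(m) / m should not
    depend on m. If m0 and m lie in M, then m0 ^ (d-1) m and m0 ^ d lie in R,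
    and linearity gives
      m0 ^ (d-1) m phi(m0) = phi(m0 ^ d m) = m0 ^ d phi(m),
    so m phi(m0) = m0 phi(m) as soon as m0 is regular ([vermod_hom_cross]).
    Taking m0 = x_1^r and m = x_2^r gives x_2^r phi(x_1^r) = x_1^r phi(x_2^r).
    The two monomials are coprime -- this is where two variables are needed --
    so phi(x_1^r) = x_1^r h for some polynomial h ([mpolyX_coprime_factor]);
    cancelling x_1^r in m phi(x_1^r) = x_1^r phi(m) yields phi(m) = h m for
    every m. As x_1^r h lies in M', the degree count above puts h in M''.

    Equivariance holds because GL(V) acts by ring automorphisms:
    g (m'' * g^-1 m) = (g m'') * m. *)

Set Implicit Arguments.
Unset Strict Implicit.
Unset Printing Implicit Defensive.

Import GRing.Theory.
Local Open Scope ring_scope.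

(** * Monomials as divisors *)

Lemma mpolyX_lreg (R : comNzRingType) (n : nat) (u : 'X_{1..n}) :
  GRing.lreg ('X_[u] : {mpoly R[n]}).
Proof.
move=> p q Epq; apply/mpolyP=> m.
by rewrite -(mcoeffMX p u m) -(mcoeffMX q u m) ![_ * 'X_[u]]mulrC Epq.
Qed.

Lemma mpolyX_factor (R : comNzRingType) (n : nat) (u : 'X_{1..n})
    (p : {mpoly R[n]}) :
  {in msupp p, forall m, (u <= m)%MM} -> exists h, p = 'X_[u] * h.
Proof.
move=> up; exists (\sum_(m <- msupp p) p@_m *: 'X_[m - u]).
rewrite mulr_sumr [LHS]mpolyE !big_seq; apply: eq_bigr => m /up um.
by rewrite -scalerAr -mpolyXD addmC submK.
Qed.

Lemma msuppXM_le (R : comNzRingType) (n : nat) (u m : 'X_{1..n})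
    (p : {mpoly R[n]}) :
  m \in msupp ('X_[u] * p) -> (u <= m)%MM.
Proof.
case/msuppM_le/allpairsP=> -[a b] /= [].
by rewrite msuppX inE => /eqP -> _ ->; apply: lem_addr.
Qed.

(** Over an arbitrary ring of coefficients there is no unique factorization, but
    divisibility by a monomial can be read off the support. *)
Lemma mpolyX_coprime_factor (R : comNzRingType) (n : nat) (u v : 'X_{1..n})
    (p q : {mpoly R[n]}) :
  (forall i, u i = 0%N \/ v i = 0%N) -> 'X_[v] * p = 'X_[u] * q ->
  exists h, p = 'X_[u] * h.
Proof.
move=> uv Epq; apply: mpolyX_factor => m pm.
have /mnm_lepP le_u : (u <= v + m)%MM.
  apply: (@msuppXM_le R _ _ _ q).
  by rewrite -Epq mulrC mcoeff_msupp mcoeffMX -mcoeff_msupp.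
apply/mnm_lepP=> i; case: (uv i) => [-> //|vi].
by have := le_u i; rewrite mnmDE vi.
Qed.

(** * Degrees of graded parts *)

Lemma degpartX (k : comNzRingType) (n : nat) (J : pred nat) (u : 'X_{1..n}) :
  J (mdeg u) -> 'X_[u] \in degpart k n J.
Proof. by move=> Ju; apply/degpartP=> m; rewrite msuppX inE => /eqP ->. Qed.

Lemma degpart_divX (k : comNzRingType) (n : nat) (J : pred nat)
    (u : 'X_{1..n}) (p : {mpoly k[n]}) :
  'X_[u] * p \in degpart k n J ->
  p \in degpart k n (fun j => J (j + mdeg u)%N).
Proof.
move/degpartP=> Jup; apply/degpartP=> m pm; rewrite addnC -mdegD; apply: Jup.
by rewrite mulrC mcoeff_msupp mcoeffMX -mcoeff_msupp.
Qed.

Lemma degpart_mod_exp (k : comNzRingType) (n d r e : nat) (p : {mpoly k[n]}) :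
  p \in degpart k n (fun j => j == r %[mod d])%N ->
  p ^+ e \in degpart k n (fun j => j == e * r %[mod d])%N.
Proof.
move=> rp; elim: e => [|e IHe].
  by apply/degpartP=> m; rewrite msupp1 inE => /eqP ->; rewrite mdeg0.
rewrite exprS; apply: degpartM rp IHe => i j /eqP ir /eqP je.
by rewrite mulSn -modnDm ir je modnDm.
Qed.

Lemma vermod_mod (k : comNzRingType) (n d r : nat) (m : vermod k n d r) :
  val m \in degpart k n (fun j => j == r %[mod d])%N.
Proof. by apply/degpartP=> u /(degpartP _ _ (valP m)) /andP[]. Qed.

(** A product of d elements of M has degrees congruent to d r, hence to 0. *)
Lemma vermod_prod_veronese (k : comNzRingType) (n d r : nat) (hd : (1 <= d)%N)
    (m m0 : vermod k n d r) :
  val m0 ^+ d.-1 * val m \in degpart k n (veronese_deg d).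
Proof.
apply: degpartM (degpart_mod_exp _ (vermod_mod m0)) (vermod_mod m).
move=> i j /eqP Ei /eqP Ej; rewrite /veronese_deg /dvdn -modnDm Ei Ej modnDm.
by rewrite -[X in (_ + X)%N]mul1n -mulnDl addn1 prednK // modnMr.
Qed.

(** Multiplication by S_i sends M into M' exactly when it sends the lowest part
    S_r of M into M', that is, when i + r is a degree of M'. For r <= r' the two
    conditions are translates of each other. Otherwise the bound r' <= i + r
    holds for all i, and r'' <= i follows from the congruence, because r'' is
    the least natural number of its class modulo d. *)
Lemma vermod_deg_shift (d r r' r'' : nat)
    (hle : (r <= r')%N -> r'' = (r' - r)%N)
    (hgt : (r' < r)%N ->
       (r'' < d)%N /\ (r''%:Z = r'%:Z - r%:Z %[mod d%:Z])%Z) (i : nat) :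
  vermod_deg d r'' i = vermod_deg d r' (i + r).
Proof.
rewrite /vermod_deg; case: (leqP r r') => [rr'|r'r].
  rewrite (hle rr') leq_subLR addnC; congr (_ && _).
  by rewrite -[in RHS](subnK rr') eqn_modDr.
have [r''d /eqP] := hgt r'r.
rewrite -(eqz_modDr r%:Z) subrK -PoszD !modz_nat eqz_nat => /eqP Er''.
rewrite (leq_trans (ltnW r'r) (leq_addl _ _)) -Er'' eqn_modDr.
case: eqP => [Ei|]; rewrite ?andbF // andbT.
by rewrite -(modn_small r''d) -Ei leq_mod.
Qed.

(** * Comparing the values of a homomorphism *)

(** The product m0 ^ d m can be read as (m0 ^ (d-1) m) m0 or as (m0 ^ d) m, each
    time with a multiplier in R; comparing the two values that R-linearity
    gives to phi(m0 ^ d m) leaves the factor m0 ^ (d-1) to cancel. *)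
Lemma vermod_hom_cross (k : comNzRingType) (n d r r' : nat) (hd : (1 <= d)%N)
    (phi : {linear vermod k n d r -> vermod k n d r'})
    (m m0 : vermod k n d r) :
  GRing.lreg (val m0) -> val m * val (phi m0) = val m0 * val (phi m).
Proof.
move=> reg0.
pose a : veronese k n d := GPart (vermod_prod_veronese hd m m0).
pose b : veronese k n d := GPart (vermod_prod_veronese hd m0 m0).
have Eab : a *: m0 = b *: m by apply: val_inj; rewrite /= mulrAC.
have /(congr1 val) /= : a *: phi m0 = b *: phi m by rewrite -!linearZ Eab.
by rewrite -!mulrA => /(lregX reg0).
Qed.

(** * The multiplication map *)

Section MulHom.
Context (k : comNzRingType) (n d r r' r'' : nat).
Context (shift : forall i, vermod_deg d r'' i = vermod_deg d r' (i + r)).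
Local Notation M := (vermod k n d r).
Local Notation M' := (vermod k n d r').
Local Notation M'' := (vermod k n d r'').

Lemma mulhom_subproof (p : M'') (m : M) :
  val p * val m \in degpart k n (vermod_deg d r').
Proof.
apply: degpartM (valP p) (valP m) => i j; rewrite shift => /andP[r'i /eqP Ei].
case/andP=> rj /eqP Ej; apply/andP; split.
  by apply: leq_trans r'i _; rewrite leq_add2l.
by rewrite -modnDmr Ej modnDmr Ei.
Qed.

Definition mulhom_fun (p : M'') (m : M) : M' := GPart (mulhom_subproof p m).

Lemma mulhom_fun_linear (p : M'') : linear (mulhom_fun p).
Proof.
by move=> a x y; apply: val_inj; rewrite /= mulrDr mulrCA.
Qed.
HB.instance Definition _ (p : M'') :=
  GRing.isLinear.Build _ _ _ *:%R (mulhom_fun p) (mulhom_fun_linear p).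

Definition mulhom (p : M'') : {linear M -> M'} := mulhom_fun p.

Lemma mulhom_linear : linear mulhom.
Proof.
move=> a p q; apply/homP=> m; apply: val_inj.
by rewrite /= mulrDl mulrA.
Qed.
HB.instance Definition _ :=
  GRing.isLinear.Build _ _ _ *:%R mulhom mulhom_linear.

Lemma mulhom_equivariant (g : GL k n) (p : M'') :
  mulhom (glact g p) = glconj g (mulhom p).
Proof.
apply/homP=> m; apply: val_inj.
by rewrite /= rmorphM /= -glsubstM GLmxV glsubst1.
Qed.

Lemma monomial_pow_subproof (i : 'I_n) :
  'X_[U_(i) *+ r] \in degpart k n (vermod_deg d r).
Proof.
by apply: degpartX; rewrite mdegMn mdeg1 mul1n /vermod_deg leqnn eqxx.
Qed.

Definition monomial_pow (i : 'I_n) : M := GPart (monomial_pow_subproof i).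

Lemma mulhom_inj (hn : (1 <= n)%N) : injective mulhom.
Proof.
move=> p q /homP/(_ (monomial_pow (Ordinal hn)))/(congr1 val)/=.
by rewrite ![_ * 'X_[_]]mulrC => /mpolyX_lreg/val_inj.
Qed.

(** The quotient h = phi(x_1^r) / x_1^r exists because it is also
    phi(x_2^r) / x_2^r, with coprime denominators. *)
Lemma mulhom_surj (hn : (2 <= n)%N) (hd : (1 <= d)%N)
    (phi : {linear M -> M'}) :
  exists p, phi = mulhom p.
Proof.
pose i0 : 'I_n := Ordinal (ltnW hn); pose i1 : 'I_n := Ordinal hn.
have cross m i : val m * val (phi (monomial_pow i)) =
    'X_[U_(i) *+ r] * val (phi m).
  by apply: vermod_hom_cross hd _ _ _ _; apply: mpolyX_lreg.
have [|h Eh] := mpolyX_coprime_factor _ (cross (monomial_pow i1) i0).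
  move=> i; rewrite !mulmnE !mnm1E.
  by case: eqP => [<-|_]; [right | left].
have hP : h \in degpart k n (vermod_deg d r'').
  have /degpart_divX/degpartP hJ := etrans (congr1 _ (esym Eh))
    (valP (phi (monomial_pow i0))).
  by apply/degpartP=> u /hJ; rewrite mdegMn mdeg1 mul1n shift.
exists (GPart hP); apply/homP=> m; apply: val_inj.
apply: (@mpolyX_lreg _ _ (U_(i0) *+ r)).
by rewrite /= -cross Eh mulrCA [h * _]mulrC.
Qed.

Lemma mulhom_bij (hn : (2 <= n)%N) (hd : (1 <= d)%N) : bijective mulhom.
Proof.
have [inv invK] := boolp.choice (mulhom_surj hn hd).
exists inv => [p|phi]; last by rewrite -invK.
by apply: (mulhom_inj (ltnW hn)); rewrite -invK.
Qed.

End MulHom.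

Theorem theorem1p7 (k : comNzRingType) (n : nat) (hn : (2 <= n)%N)
    (d : nat) (hd : (1 <= d)%N) (r r' r'' : nat)
    (hle : (r <= r')%N -> r'' = (r' - r)%N)
    (hgt : (r' < r)%N ->
       (r'' < d)%N /\ (r''%:Z = r'%:Z - r%:Z %[mod d%:Z])%Z) :
  exists Phi : {linear vermod k n d r'' ->
                  {linear vermod k n d r -> vermod k n d r'}},
    [/\ forall (m'' : vermod k n d r'') (m : vermod k n d r),
          gpval (Phi m'' m) = gpval m'' * gpval m,
        bijective Phi &
        forall (g : GL k n) (m'' : vermod k n d r''),
          Phi (glact g m'') = glconj g (Phi m'')].
Proof.
have shift := vermod_deg_shift hle hgt.
exists (mulhom shift); split=> //; first exact: mulhom_bij.
exact: mulhom_equivariant.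
Qed.
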